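(* For every integer $n\ge 0$, \[ \sum_{k=-\infty}^{\infty}(-1)^k\,\overline{p}_o\!\left(n-\frac{k(3k+1)}{2}\right)=\sum_{k=-\infty}^{\infty}(-1)^k\,p_{do}\bigl(n-k(3k+1)\bigr). \]
   Context: $\overline{p}_o(n)$ is the number of overpartitions of $n$ into odd parts (partitions into odd parts in which the first occurrence of each part size may be overlined), with $\sum_{n\ge0}\overline{p}_o(n)q^n=\frac{(-q;q^2)_\infty}{(q;q^2)_\infty}$, where $(a;q)_\infty=\prod_{k\ge1}(1-aq^{k-1})$. $p_{do}(n)$ is the number of partitions of $n$ into distinct odd parts, $\sum_{n\ge0}p_{do}(n)q^n=(-q;q^2)_\infty$. Convention: these functions vanish at arguments that are not nonnegative integers. *)

(* Defs.v *)
From HB Require Import structures.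
From mathcomp Require Import all_boot all_order all_algebra.
From mathcomp Require Import boolp classical_sets cardinality fsbigop.
From mathcomp Require Import zify ring.

Set Implicit Arguments.
Unset Strict Implicit.
Unset Printing Implicit Defensive.

Import Order.TTheory GRing.Theory Num.Theory.

Definition is_partition (n : nat) (s : seq nat) : bool :=
  [&& sorted geq s, all (fun a => 0 < a) s & sumn s == n].

(* A pair (a, b) is a part of size a, which is overlined when b = true. *)
Definition is_overpartition (n : nat) (s : seq (nat * bool)) : bool :=
  is_partition n (unzip1 s) &&
  pairwise (fun x y : nat * bool => (x.1 == y.1) ==> ~~ y.2) s.

(* The parts being positive, a partition of n has at most n parts, all of them
   at most n, so the bounded sequences below miss no (over)partition of n. *)
Definition overp_odd (n : nat) : nat :=
  #|[pred s : {bseq n of 'I_n.+1 * bool} |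
      let t := [seq (val x.1, x.2) | x <- s] in
      is_overpartition n t && all odd (unzip1 t)]|.

Definition p_dist_odd (n : nat) : nat :=
  #|[pred s : {bseq n of 'I_n.+1} |
      let t := [seq val x | x <- s] in
      [&& is_partition n t, uniq t & all odd t]]|.

Local Open Scope ring_scope.

Definition ext0 (f : nat -> nat) (m : int) : int :=
  if m is Posz n then (f n)%:Z else 0.

Lemma pentagonal_dvd2 (k : int) : (2 %| k * (3 * k + 1))%Z.
Proof.
rewrite (divz_eq k 2); set q := (k %/ 2)%Z.
have /andP[r0 r2] : (0 <= (k %% 2)%Z < 2) by rewrite modz_ge0 //= ltz_mod.
have [->|->] : (k %% 2)%Z = 0 \/ (k %% 2)%Z = 1 by lia.
  by apply/dvdzP; exists (q * (6 * q + 1)); ring.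
by apply/dvdzP; exists ((2 * q + 1) * (3 * q + 2)); ring.
Qed.

Lemma finite_absz_le (n : nat) (A : set int) :
  (forall k, A k -> (`|k| <= n)%N) -> finite_set A.
Proof.
move=> An; pose s := [seq i%:Z | i <- iota 0 n.+1].
apply: (@sub_finite_set _ _ [set` s ++ [seq - i | i <- s]]); last first.
  exact: finite_seq.
move=> k /An kn; rewrite /mkset mem_cat; apply/orP.
have [k0|k0] := leP 0 k; [left|right].
  by apply/mapP; exists `|k|%N; rewrite ?mem_iota; lia.
apply/mapP; exists (- k); last by rewrite opprK.
by apply/mapP; exists `|k|%N; rewrite ?mem_iota; lia.
Qed.

(* The sums over all integers k are written with the finite-support operator
   [\sum_(k \in setT)], whose value is 0 when the support is infinite; the next
   two lemmas show that this never happens for the sums of interest. *)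
Lemma finite_pentagonal_support (f : nat -> nat) (n : nat) :
  finite_set [set k : int |
    (-1) ^ k * ext0 f (n%:Z - (k * (3 * k + 1) %/ 2)%Z) != 0]%classic.
Proof.
apply: (@finite_absz_le n) => k /=.
have [c ck] := dvdzP (pentagonal_dvd2 k); rewrite ck mulzK //.
have [nc|nc _] := ltP n%:Z c; last by nia.
suff -> : ext0 f (n%:Z - c) = 0 by rewrite mulr0 eqxx.
by have : n%:Z - c < 0; [lia | case: (n%:Z - c)].
Qed.

Lemma finite_double_pentagonal_support (f : nat -> nat) (n : nat) :
  finite_set [set k : int |
    (-1) ^ k * ext0 f (n%:Z - k * (3 * k + 1)) != 0]%classic.
Proof.
apply: (@finite_absz_le n) => k /=.
set c := k * _; have [nc|nc _] := ltP n%:Z c; last by rewrite /c in nc; nia.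
suff -> : ext0 f (n%:Z - c) = 0 by rewrite mulr0 eqxx.
by have : n%:Z - c < 0; [lia | case: (n%:Z - c)].
Qed.

(* Main.v *)
Require Import Defs.
From HB Require Import structures.
From mathcomp Require Import all_boot all_order all_algebra.
From mathcomp Require Import boolp classical_sets cardinality fsbigop.
From mathcomp Require Import zify ring.

(** Since (q;q) = (q;q^2) (q^2;q^2), multiplying the generating function
    (-q;q^2) / (q;q^2) of overpartitions into odd parts by (q;q) gives
    (q^2;q^2) (-q;q^2), i.e. the generating function of partitions into
    distinct odd parts multiplied by (q^2;q^2).  Expanding (q;q) and (q^2;q^2)
    by Euler's pentagonal number theorem and comparing coefficients of q^n gives
    the identity.  All series are replaced by polynomials modulo q^(n+1).  The
    pentagonal number theorem comes from Shanks' finite identity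
      sum_(0 <= s <= n) (-1)^s (1 - q^(s+1)) ... (1 - q^n) q^(s n + s (s+1) / 2)
        = sum_(-n <= k <= n) (-1)^k q^(k (3k+1) / 2),
    whose terms with s > 0 are all divisible by q^(n+1). *)

Set Implicit Arguments.
Unset Strict Implicit.
Unset Printing Implicit Defensive.

Import Order.TTheory GRing.Theory Num.Theory.
Local Open Scope ring_scope.

(** * Pentagonal numbers and the truncated pentagonal number theorem *)

(** As k(3k+1) is even and nonnegative, neither the division nor the absolute value loses
    anything. *)
Definition pent (k : int) : nat := `|(k * (3 * k + 1) %/ 2)%Z|%N.

Lemma pentE (k : int) : (pent k)%:Z * 2 = k * (3 * k + 1).
Proof.
rewrite /pent; have [c ck] := dvdzP (pentagonal_dvd2 k); rewrite ck mulzK //.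
nia.
Qed.

Definition zrange (n : nat) : seq int :=
  [seq Posz i | i <- iota 0 n.+1] ++ [seq Negz i | i <- iota 0 n].

Lemma zrange_uniq n : uniq (zrange n).
Proof.
rewrite cat_uniq !map_inj_uniq ?iota_uniq /= ?andbT; [| by move=> ? ? []..].
by apply/hasPn => _ /mapP[i _ ->]; apply/negP => /mapP[].
Qed.

Lemma mem_zrange n k : (k \in zrange n) = (`|k| <= n)%N.
Proof.
rewrite mem_cat; apply/orP/idP => [[] /mapP[i]|]; rewrite ?mem_iota.
- by move=> ? ->; lia.
- by move=> ? ->; lia.
case: k => i le_in; [left|right]; apply/mapP; exists i => //;
  rewrite mem_iota; lia.
Qed.

Definition shanks_term (R : comNzRingType) (q : R) (n s : nat) : R :=
  (-1) ^+ s * (\prod_(s <= i < n) (1 - q ^+ i.+1)) * q ^+ (s * n + 'C(s.+1, 2)).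

(* The differences of consecutive sums telescope in the summation index s. *)
Lemma shanks_diff (R : comNzRingType) (q : R) (n m : nat) : (m <= n)%N ->
  \sum_(s < m.+1) (shanks_term q n.+1 s - shanks_term q n s) =
  - ((-1) ^+ m * (\prod_(m <= i < n) (1 - q ^+ i.+1)) *
     q ^+ (m.+1 * n.+1 + 'C(m.+1, 2))).
Proof.
elim: m => [_|m IHm lt_mn].
  rewrite big_ord1 /shanks_term big_nat_recr //= !mul0n mul1n !expr0 !mul1r.
  by rewrite bin_small // !addn0; ring.
rewrite big_ord_recr (IHm (ltnW lt_mn)) /= /shanks_term big_nat_recr //=.
rewrite (big_ltn lt_mn).
(* All exponents are written over the common part [m.+1 * n + 'C(m.+2, 2)], which leaves a
   polynomial identity. *)
have -> : (m.+1 * n.+1 + 'C(m.+2, 2) = m.+1 * n + 'C(m.+2, 2) + m.+1)%N by lia.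
have -> : (m.+2 * n.+1 + 'C(m.+2, 2) =
    m.+1 * n + 'C(m.+2, 2) + m.+1 + n.+1)%N by lia.
have -> : (m.+1 * n.+1 + 'C(m.+1, 2) = m.+1 * n + 'C(m.+2, 2))%N.
  by rewrite [in RHS]binS bin1; lia.
rewrite !exprD [(-1) ^+ m.+1]exprS.
set p := \prod_(_ <= i < _) _.
set y := q ^+ m.+1; set z := q ^+ n.+1.
by ring.
Qed.

(** Induction on n: the boundary term of [shanks_diff] at m = n is the summand k = -(n+1), and the
    new term s = n+1 is the summand k = n+1. *)
Lemma shanks (R : comNzRingType) (q : R) (n : nat) :
  \sum_(s < n.+1) shanks_term q n s =
  \sum_(k <- zrange n) (-1) ^+ `|k|%N * q ^+ pent k.
Proof.
rewrite /zrange big_cat !big_map -!/(index_iota 0 _)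
  -[iota 0 n.+1]/(index_iota 0 n.+1).
rewrite -[iota 0 n](congr1 (iota 0) (subn0 n)) -/(index_iota 0 n).
elim: n => [|n IHn].
  by rewrite big_ord1 big_nat1 big_geq // /shanks_term big_geq //=
    mulr1 addr0 bin_small // mulr1.
have := shanks_diff q (leqnn n).
rewrite sumrB IHn => /eqP; rewrite subr_eq => /eqP E.
rewrite big_ord_recr /= E /shanks_term
  [\prod_(n.+1 <= i < n.+1) _]big_geq // [\prod_(n <= i < n) _]big_geq //
  [in RHS]big_nat_recr //=.
rewrite [X in _ = _ + X]big_nat_recr //=.
have -> : pent n.+1 = (n.+1 * n.+1 + 'C(n.+2, 2))%N.
  by have := pentE n.+1; have := mul_bin_diag n.+2 1; rewrite bin1 /=; lia.
have -> : pent (Negz n) = (n.+1 * n.+1 + 'C(n.+1, 2))%N.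
  by have := pentE (Negz n); have := mul_bin_diag n.+1 1;
    rewrite bin1 NegzE /=; lia.
by rewrite /= [(-1) ^+ n.+1]exprS; ring.
Qed.

Lemma pentagonal_truncated (R : comNzRingType) (q : R) (n : nat) :
  exists r : R, \sum_(k <- zrange n) (-1) ^+ `|k|%N * q ^+ pent k =
    \prod_(i < n) (1 - q ^+ i.+1) + q ^+ n.+1 * r.
Proof.
rewrite -shanks big_ord_recl.
(* The terms of index s+1, with q^(n+1) factored out; the subtraction is exact because ['C(s.+2, 2)]
   is positive. *)
exists (\sum_(s < n) (-1) ^+ s.+1 * (\prod_(s.+1 <= i < n) (1 - q ^+ i.+1)) *
   q ^+ (s * n + 'C(s.+2, 2) - 1)).
congr (_ + _).
  by rewrite /shanks_term mul1r mul0n bin_small // mulr1 big_mkord.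
rewrite mulr_sumr; apply: eq_bigr => s _; rewrite /shanks_term.
have -> : (bump 0 s * n + 'C((bump 0 s).+1, 2) =
    n.+1 + (s * n + 'C(s.+2, 2) - 1))%N.
  rewrite /bump leq0n add1n; have : (0 < 'C(s.+2, 2))%N by rewrite bin_gt0.
  lia.
by rewrite exprD; ring.
Qed.

(** * Enumeration of coded partitions *)

(* Parts are coded by natural numbers: a part c may be used if ok c, contributes
   w c to the sum, and may be repeated iff rep c.  Overpartitions into odd parts
   and partitions into distinct odd parts are both instances. *)
Section Counting.
Variables (ok rep : pred nat) (w : nat -> nat).
Hypothesis w_gt0 : forall c, ok c -> (0 < w c)%N.

Definition precedes : rel nat := fun c d => (d < c)%N || (d == c) && rep c.

Definition is_config (m n : nat) (s : seq nat) : bool :=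
  [&& pairwise precedes s, all (fun c => ok c && (c < m)%N) s &
      sumn (map w s) == n].

(* The fuel k is sufficient when m + n < k. *)
Fixpoint configs_rec (k m n : nat) {struct k} : seq (seq nat) :=
  match k, m with
  | k'.+1, m'.+1 =>
      configs_rec k' m' n ++
      (if ok m' && (w m' <= n)%N then
         [seq m' :: s | s <-
            configs_rec k' (if rep m' then m'.+1 else m') (n - w m')]
       else [::])
  | _.+1, 0%N => if n == 0%N then [:: [::]] else [::]
  | 0%N, _ => [::]
  end.

Lemma is_config_nil m n : is_config m n [::] = (n == 0%N).
Proof. by rewrite /is_config /= eq_sym. Qed.

Lemma is_config0_cons n c s : is_config 0 n (c :: s) = false.
Proof. by rewrite /is_config /= ltn0 andbF andbF. Qed.

Lemma is_config_cons m n c s :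
  is_config m n (c :: s) =
  [&& ok c, (c < m)%N, (w c <= n)%N &
      is_config (if rep c then c.+1 else c) (n - w c) s].
Proof.
rewrite /is_config /=.
have -> : (w c + sumn (map w s) == n)%N =
          (w c <= n)%N && (sumn (map w s) == (n - w c)%N) by lia.
have [okc|] := boolP (ok c); last by rewrite /= andbF.
have [cm|] := boolP (c < m)%N; last by rewrite /= andbF.
have [_|] := boolP (w c <= n)%N; last by rewrite /= !andbF.
rewrite /=; case: (pairwise _ _); last by rewrite !andbF.
rewrite /= !andbT; case: (sumn _ == _); last by rewrite !andbF.
rewrite !andbT -all_predI; apply: eq_all => d /=; rewrite /precedes.
by case: (ok d); case: (rep c); rewrite ?andbF //=; lia.
Qed.

(** Codes decrease, so the largest admissible code m, if used, comes first; it stays available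
    afterwards only when repeatable. *)
Lemma is_configS m n s :
  is_config m.+1 n s = is_config m n s ||
    [&& ok m, (w m <= n)%N &
      (s != [::]) && (head 0%N s == m) &&
      is_config (if rep m then m.+1 else m) (n - w m) (behead s)].
Proof.
case: s => [|c s]; first by rewrite !is_config_nil !andbF orbF.
rewrite !is_config_cons /=.
have [->|nc] := eqVneq c m; first by rewrite ltnn ltnS leqnn andbF.
by rewrite !andbF orbF ltnS leq_eqVlt (negPf nc).
Qed.

(** Every recursive call lowers m + n: if m is kept for a repeatable code, n drops by a positive
    weight. *)
Lemma mem_configs_rec k m n s :
  (m + n < k)%N -> (s \in configs_rec k m n) = is_config m n s.
Proof.
elim: k m n s => // k IHk [|m] n s lt_k /=.
  case: s => [|c s]; last by rewrite is_config0_cons; case: ifP.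
  by rewrite is_config_nil; case: ifP.
rewrite mem_cat IHk; last by lia.
rewrite is_configS; congr (_ || _).
have [okm|] /= := boolP (ok m); last by [].
have [wn|] /= := boolP (w m <= n)%N; last by [].
have w0 := w_gt0 okm.
apply/mapP/andP => [[t]|[/andP[]]].
  by rewrite IHk; [move=> ? -> /=; rewrite eqxx | case: (rep m); lia].
case: s => //= c s _ /eqP -> Ps; exists s => //.
by rewrite IHk //; case: (rep m); lia.
Qed.

Lemma configs_rec_uniq k m n : (m + n < k)%N -> uniq (configs_rec k m n).
Proof.
elim: k m n => // k IHk [|m] n lt_k /=; first by case: ifP.
rewrite cat_uniq IHk ?andTb; last by lia.
case: ifP => [/andP[okm wn]|//].
have w0 := w_gt0 okm.
rewrite map_inj_uniq ?IHk; [|by case: (rep m); lia | by move=> ? ? []].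
rewrite andbT; apply/hasPn => _ /mapP[t _ ->].
by rewrite mem_configs_rec ?is_config_cons ?ltnn ?andbF //; lia.
Qed.

Definition configs m n := configs_rec (m + n).+1 m n.

Lemma mem_configs m n s : (s \in configs m n) = is_config m n s.
Proof. exact: mem_configs_rec. Qed.

Lemma configs_uniq m n : uniq (configs m n).
Proof. exact: configs_rec_uniq. Qed.

Lemma size_configs_rec k m n :
  (m + n < k)%N -> size (configs_rec k m n) = size (configs m n).
Proof.
move=> lt_k; apply: perm_size; apply: uniq_perm.
- exact: configs_rec_uniq.
- exact: configs_uniq.
by move=> s; rewrite mem_configs mem_configs_rec.
Qed.

Lemma size_configs0 n : size (configs 0 n) = (n == 0%N).
Proof. by rewrite /configs /=; case: ifP. Qed.

Lemma size_configsS m n :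
  size (configs m.+1 n) = (size (configs m n) +
    if ok m && (w m <= n)
    then size (configs (if rep m then m.+1 else m) (n - w m)) else 0)%N.
Proof.
rewrite {1}/configs /= size_cat.
congr addn; case: ifP => // /andP[okm wn].
have w0 := w_gt0 okm.
by rewrite size_map; apply: (@size_configs_rec (m + n).+1); case: (rep m); lia.
Qed.

End Counting.

(** * Generating polynomials modulo X^K *)

Definition coef_eq (K : nat) (p q : {poly int}) :=
  forall i, (i < K)%N -> p`_i = q`_i.

Lemma coef_eq_mul K p p' q q' :
  coef_eq K p p' -> coef_eq K q q' -> coef_eq K (p * q) (p' * q').
Proof.
move=> pp qq i iK; rewrite !coefM; apply: eq_bigr => j _.
by rewrite pp ?qq //; have := ltn_ord j; lia.
Qed.

Definition gen_poly (K : nat) (f : nat -> nat) : {poly int} :=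
  \poly_(i < K) (f i)%:Z.

(** Let F_m be the generating polynomial. Modulo X^K, an admissible code m of weight w gives F_(m+1)
    = F_m + X^w F_(m+1) if repeatable and F_(m+1) = (1 + X^w) F_m otherwise. Keeping the factors 1 -
    X^w on the left avoids inverses. *)
Lemma configs_gen (ok rep : pred nat) (w : nat -> nat) (K m : nat) :
  (forall c, ok c -> (0 < w c)%N) ->
  coef_eq K
    ((\prod_(c < m | ok c && rep c) (1 - 'X^(w c))) *
     gen_poly K (fun n => size (configs ok rep w m n)))
    (\prod_(c < m | ok c && ~~ rep c) (1 + 'X^(w c))).
Proof.
move=> w0; elim: m => [|m IHm] i iK.
  rewrite !big_ord0 mul1r coef_poly iK size_configs0 coef1.
  by case: (i == _).
have G j : (j < K)%N ->
  (gen_poly K (fun n => size (configs ok rep w m.+1 n)))`_j =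
  (gen_poly K (fun n => size (configs ok rep w m n)) +
   (if ok m then 'X^(w m) * gen_poly K (fun n => size
      (configs ok rep w (if rep m then m.+1 else m) n)) else 0))`_j.
  move=> jK; rewrite coefD !coef_poly jK size_configsS // PoszD; congr (_ + _).
  case: (ok m) => /=; last by rewrite coef0.
  rewrite coefXnM ltnNge; case: (leqP (w m) j) => //= ?.
  by rewrite coef_poly (_ : (j - w m < K)%N = true) //; lia.
rewrite big_mkcond big_ord_recr -big_mkcond.
rewrite [in RHS]big_mkcond [in RHS]big_ord_recr -[in RHS]big_mkcond /=.
case: (boolP (ok m)) G => [okm|nok] G /=; last first.
  rewrite !mulr1 -IHm //.
  by apply: coef_eq_mul iK => // j jK; rewrite G // addr0.
case: (boolP (rep m)) G => [rm|nrm] G /=.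
  rewrite mulr1 -IHm // -mulrA; apply: (coef_eq_mul (K := K)) => // j jK.
  by rewrite mulrBl mul1r coefB G // coefD addrK.
rewrite mulr1 [_ * (1 + 'X^(w m))]mulrC.
rewrite -(coef_eq_mul (p := 1 + 'X^(w m)) (K := K) _ IHm) // mulrCA.
apply: (coef_eq_mul (K := K)) => // j jK.
by rewrite G // mulrDl mul1r.
Qed.

(** * From the cardinals in the definitions to coded partitions *)

Lemma leq_sumn (s : seq nat) (x : nat) : x \in s -> (x <= sumn s)%N.
Proof.
elim: s => //= y s IHs; rewrite inE => /orP[/eqP->|/IHs]; lia.
Qed.

Lemma size_le_sumn (s : seq nat) :
  all (fun x => 0 < x)%N s -> (size s <= sumn s)%N.
Proof. by elim: s => //= y s IHs /andP[y0 /IHs]; lia. Qed.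

(** Positive weights bound the length of a configuration by n, and each weight is at most n, so
    decoding by [h'] needs to be correct only there. *)
Lemma card_configs (ok rep : pred nat) (w : nat -> nat) (m n : nat)
    (A : finType) (h : A -> nat) (h' : nat -> A) (P : pred {bseq n of A}) :
  (forall c, ok c -> (0 < w c)%N) ->
  injective h -> (forall c, (w c <= n)%N -> h (h' c) = c) ->
  (forall s : {bseq n of A}, P s = is_config ok rep w m n (map h s)) ->
  #|P| = size (configs ok rep w m n).
Proof.
move=> w0 h_inj h'K PE.
rewrite cardE -(size_map (fun s : {bseq n of A} => map h s)).
apply: perm_size; apply: uniq_perm.
- rewrite map_inj_uniq ?enum_uniq // => s t /(inj_map h_inj); exact: val_inj.
- exact: configs_uniq.
move=> u; rewrite mem_configs //; apply/mapP/idP => [[s]|cu].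
  by rewrite mem_enum unfold_in PE => ? ->.
have /and3P[_ /allP u_ok /eqP sum_u] := cu.
have su : (size (map h' u) <= n)%N.
  rewrite size_map -(size_map w) -[leqRHS]sum_u; apply: size_le_sumn.
  by rewrite all_map; apply/allP => c /u_ok /andP[/w0].
have hu : map h (map h' u) = u.
  rewrite -map_comp -[RHS]map_id; apply/eq_in_map => c cu' /=; apply: h'K.
  by rewrite -sum_u; apply: leq_sumn; apply: map_f.
by exists (Bseq su) => //; rewrite mem_enum unfold_in PE /= hu.
Qed.

(* An overlined part sorts just before the plain parts of its size, so with this
   code only the even codes are repeatable. *)
Definition over_code (x : nat * bool) : nat := (x.1.*2 + x.2)%N.

Lemma over_config (m n : nat) (t : seq (nat * bool)) : (n.*2.+1 < m)%N ->
  is_overpartition n t && all odd (unzip1 t) =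
  is_config (fun c => odd c./2) (fun c => ~~ odd c) half m n (map over_code t).
Proof.
move=> nm; rewrite /is_overpartition /is_partition /is_config.
have half_code x : (over_code x)./2 = x.1.
  by rewrite /over_code addnC; case: x => a b /=; rewrite half_bit_double.
rewrite -map_comp (eq_map (g := fst) half_code).
case: eqP => [sum_t|]; last by rewrite !andbF.
rewrite !andbT (sorted_pairwise (rev_trans leq_trans)) /unzip1 !pairwise_map.
(* With equal sizes, the later part must be plain: its even code is then at most the earlier one,
   and only even codes repeat. *)
have -> : pairwise (relpre over_code (precedes (fun c => ~~ odd c))) t =
    pairwise (relpre fst geq) t &&
    pairwise (fun x y : nat * bool => (x.1 == y.1) ==> ~~ y.2) t.
  rewrite -pairwise_relI; apply: eq_pairwise => -[a b] [c d] /=.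
  by rewrite /precedes /over_code /=; case: b; case: d => /=; lia.
rewrite -!andbA; case: pairwise => //=.
rewrite andbCA; case: pairwise => //=.
rewrite !all_map -all_predI; apply: eq_in_all => x xt /=.
rewrite half_code; have : (x.1 <= n)%N by rewrite -sum_t; apply/leq_sumn/map_f.
by rewrite /over_code; case: x {xt} => a [] /=; lia.
Qed.

Lemma overp_oddE (m n : nat) : (n.*2.+1 < m)%N ->
  overp_odd n =
  size (configs (fun c => odd c./2) (fun c => ~~ odd c) half m n).
Proof.
move=> nm; rewrite /overp_odd.
apply: (@card_configs _ _ _ _ _ _
  (fun x : 'I_n.+1 * bool => over_code (val x.1, x.2))
  (fun c => (inord c./2, odd c))).
- by move=> c; case: (c./2).
- move=> [a b] [c d]; rewrite /over_code /= => E.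
  have -> : b = d by move: E; case: b; case: d => //=; lia.
  congr pair; apply: val_inj => /=; lia.
- move=> c cn; rewrite /over_code /= inordK ?ltnS //.
  by rewrite addnC odd_double_half.
by move=> s /=; rewrite (over_config _ nm) -map_comp.
Qed.

Lemma distinct_config (m n : nat) (t : seq nat) : (n < m)%N ->
  [&& is_partition n t, uniq t & all odd t] =
  is_config odd pred0 id m n t.
Proof.
move=> nm; rewrite /is_partition /is_config map_id.
case: eqP => [sum_t|]; last by rewrite !andbF.
rewrite (sorted_pairwise (rev_trans leq_trans)) uniq_pairwise.
have -> : pairwise (precedes pred0) t =
    pairwise geq t && pairwise (fun x y => x != y) t.
  rewrite -pairwise_relI; apply: eq_pairwise => x y.
  by rewrite /precedes /=; lia.
rewrite !andbT -!andbA; case: pairwise => //=.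
rewrite andbCA; case: pairwise => //=.
rewrite -all_predI; apply: eq_in_all => x xt /=.
have : (x <= n)%N by rewrite -sum_t; apply: leq_sumn.
lia.
Qed.

Lemma p_dist_oddE (m n : nat) : (n < m)%N ->
  p_dist_odd n = size (configs odd pred0 id m n).
Proof.
move=> nm; rewrite /p_dist_odd.
apply: (@card_configs _ _ _ _ _ _ (@nat_of_ord n.+1) inord).
- by case.
- exact: val_inj.
- by move=> c cn; rewrite inordK.
by move=> s /=; rewrite (distinct_config _ nm).
Qed.

(** * Products over odd parts *)

Lemma prod_odd_codes (R : comNzRingType) (f : nat -> R) (n : nat) (b : bool) :
  \prod_(c < n.*2.+1.*2 | odd c./2 && (odd c == b)) f c./2 =
  \prod_(i < n) f i.*2.+1.
Proof.
elim: n => [|n IHn].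
  by rewrite big_mkcond !big_ord_recr !big_ord0 /= !mulr1.
(* The four new codes belong to the sizes 2n+1 and 2n+2, two each; only the code of size 2n+1 and
   parity b contributes. *)
have -> : n.+1.*2.+1.*2 = n.*2.+1.*2.+4 by lia.
rewrite big_mkcond 4!big_ord_recr -big_mkcond IHn /=.
rewrite [RHS]big_ord_recr /=.
rewrite !uphalf_half !doubleK /= !odd_double /=.
by case: b {IHn}; rewrite /= ?mulr1.
Qed.

Lemma prod_odd (R : comNzRingType) (f : nat -> R) (n : nat) :
  \prod_(c < n.*2.+1 | odd c) f c = \prod_(i < n) f i.*2.+1.
Proof.
elim: n => [|n IHn].
  by rewrite big_mkcond !big_ord_recr !big_ord0 /= !mulr1.
rewrite doubleS big_mkcond 2!big_ord_recr -big_mkcond IHn [RHS]big_ord_recr /=.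
by rewrite odd_double /= mulr1.
Qed.

Lemma prod_double (R : comNzRingType) (f : nat -> R) (n : nat) :
  \prod_(i < n.*2) f i = (\prod_(i < n) f i.*2) * (\prod_(i < n) f i.*2.+1).
Proof.
elim: n => [|n IHn]; first by rewrite !big_ord0 mulr1.
by rewrite doubleS !big_ord_recr /= IHn; ring.
Qed.

(** * Sums over all integers as coefficients, and the identity *)

Lemma signz_absz (k : int) : (-1) ^ k = (-1) ^+ `|k|%N :> int.
Proof. by case: k => // m; rewrite NegzE -exprnN -exprVn invrN1. Qed.

Lemma leq_absz_pent k : (`|k| <= pent k)%N.
Proof. by have := pentE k; nia. Qed.

(** Since |k| is at most [pent k], indices with |k| > N give negative arguments. Multiplying by X^e
    shifts coefficients and yields 0 when e > n, in agreement with [ext0]. *)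
Lemma pentagonal_fsum_coef (f : nat -> nat) (d n N : nat) :
  (0 < d)%N -> (n <= N)%N ->
  \sum_(k \in [set: int]%classic) (-1) ^ k * ext0 f (n%:Z - (d * pent k)%:Z) =
  ((\sum_(k <- zrange N) (-1) ^+ `|k|%N * 'X^d ^+ pent k) *
   gen_poly n.+1 f)`_n.
Proof.
move=> d0 nN; pose e k := (d * pent k)%N.
have ext_lt k : (n < e k)%N -> ext0 f (n%:Z - (e k)%:Z) = 0.
  by move=> ?; have : n%:Z - (e k)%:Z < 0; [lia | case: (n%:Z - (e k)%:Z)].
rewrite (fsbigE (zrange N)) ?zrange_uniq //=; last first.
  move=> k _; rewrite mem_zrange => ?; rewrite ext_lt ?mulr0 // /e.
  by have := leq_absz_pent k; nia.
rewrite mulr_suml coef_sum; apply: eq_big => [k|k _].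
  by rewrite in_setT.
rewrite -mulrA -(rmorphN1 (@polyC int)) -rmorphXn coefCM signz_absz.
rewrite -exprM coefXnM -/(e k); congr (_ * _).
case: ltnP => [/ext_lt//|le_en].
by rewrite coef_poly subzn // ltnS leq_subr.
Qed.

Theorem theorem3p11 (n : nat) :
  \sum_(k \in [set: int]%classic)
     (-1) ^ k * ext0 overp_odd (n%:Z - (k * (3 * k + 1) %/ 2)%Z)
  = \sum_(k \in [set: int]%classic)
     (-1) ^ k * ext0 p_dist_odd (n%:Z - k * (3 * k + 1)).
Proof.
have pent_ge0 k : (k * (3 * k + 1) %/ 2)%Z = (pent k)%:Z.
  by rewrite -pentE mulzK.
under eq_fsbigr do rewrite pent_ge0 -[pent _]mul1n.
under [RHS]eq_fsbigr => k _ do rewrite -pentE -PoszM mulnC.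
(* The cutoff 2n makes the product for (q;q) split into exactly n even and n odd factors, matching
   the cutoff n used for (q^2;q^2). *)
rewrite (@pentagonal_fsum_coef _ 1 n n.*2) //; last by lia.
rewrite (@pentagonal_fsum_coef _ 2 n n) //.
have [r ->] := pentagonal_truncated ('X : {poly int}) n.*2.
have [r' ->] := pentagonal_truncated ('X^2 : {poly int}) n.
set E := \prod_(i < n) (1 - 'X^2 ^+ i.+1).
set O := gen_poly _ overp_odd; set Q := gen_poly _ p_dist_odd.
have trunc p s N : (n < N)%N -> coef_eq n.+1 (p + 'X^N * s) p.
  move=> nN i iK; rewrite coefD coefXnM ifT ?addr0 //; lia.
pose U : {poly int} := \prod_(i < n) (1 + 'X^(i.*2.+1)).
pose D : {poly int} := \prod_(i < n) (1 - 'X^(i.*2.+1)).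
have DO : coef_eq n.+1 (D * O) U.
  (* The code bound 4n+2 exceeds 2i+1 for all i up to n and covers exactly the n odd sizes occurring
     in [D] and [U]. *)
  rewrite /O (_ : gen_poly _ _ = gen_poly n.+1 (fun i => size
    (configs (fun c => odd c./2) (fun c => ~~ odd c) half n.*2.+1.*2 i)));
    last first.
    by apply: eq_poly => i iK; rewrite -overp_oddE //; lia.
  have -> : D = \prod_(c < n.*2.+1.*2 | odd c./2 && ~~ odd c) (1 - 'X^(c./2)).
    rewrite /D -(prod_odd_codes (fun i => 1 - 'X^i) n false).
    by apply: eq_bigl => c; rewrite eqbF_neg.
  have -> : U = \prod_(c < n.*2.+1.*2 | odd c./2 && ~~ ~~ odd c)
      (1 + 'X^(c./2)).
    rewrite /U -(prod_odd_codes (fun i => 1 + 'X^i) n true).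
    by apply: eq_bigl => c; rewrite eqb_id negbK.
  by apply: configs_gen => c; case: (c./2).
have QU : coef_eq n.+1 Q U.
  rewrite /Q (_ : gen_poly _ _ = gen_poly n.+1 (fun i => size
    (configs odd pred0 id n.*2.+1 i))); last first.
    by apply: eq_poly => i iK; rewrite -p_dist_oddE //; lia.
  have := @configs_gen odd pred0 id n.+1 n.*2.+1.
  rewrite big_pred0 ?mul1r => [|c]; last by rewrite andbF.
  under eq_bigl do rewrite andbT.
  by rewrite (prod_odd (fun i => 1 + 'X^i)); apply; case.
have PDE : \prod_(i < n.*2) (1 - 'X^(i.+1)) = E * D.
  rewrite (prod_double (fun i => 1 - 'X^(i.+1))) mulrC; congr (_ * _).
  by apply: eq_bigr => i _; rewrite -exprM mul2n doubleS.
(* Modulo X^(n+1), the left side is E D O = E U and the right side is E Q = E U. *)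
transitivity ((E * D * O)`_n).
  apply: (coef_eq_mul (K := n.+1)) => //; rewrite PDE; apply: trunc; lia.
transitivity ((E * U)`_n).
  by rewrite -mulrA; apply: (coef_eq_mul (K := n.+1)).
apply/esym/(coef_eq_mul (K := n.+1)) => //.
by rewrite -exprM; apply: trunc; lia.
Qed.
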